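(* Let $\rho>0$, $\beta\in(0,1)$, $x^0\in X$, and put $\gamma_\rho:=1-\beta/\max\{2,4\rho/\mu^*\}$ and $\theta_\rho:=L/(L+(1-\beta)\rho)$. For $0<\varepsilon<f(x^0)-f^*$, define $$S_\varepsilon:=\left\lceil\log_{1/\gamma_\rho}\frac{f(x^0)-f^*}{\beta\min\{1/2,\mu^*/(4\rho)\}\varepsilon}\right\rceil,\qquad P_\varepsilon:=\left\lceil\log_{1/\theta_\rho}\left((3-2\beta)^{S_\varepsilon}\max\left\{1,\frac{\|g(x^0)\|^2}{\min\{\rho,\mu^*/2\}\varepsilon}\right\}\right)\right\rceil .$$ Then the full-memory proximal bundle method (FM-PBM) with inputs $x^0,\rho,\beta$ reaches a serious center $x^t$ (a center produced by a serious step) satisfying $f(x^t)-f^*\le\varepsilon$ after at most $$T_\varepsilon^{\rm FM}=O\bigl(k(S_\varepsilon+P_\varepsilon)\bigr)$$ first-order oracle calls.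
   Context: Setting. $X\subseteq\mathbb R^n$ is a nonempty closed convex set, $f:X\to\mathbb R$ is convex, lower semicontinuous and attains its minimum $f^*=\min_{X}f$; $X^*=\operatorname{argmin}_X f$. $\|\cdot\|$, $\langle\cdot,\cdot\rangle$ are the Euclidean norm and inner product. For $x\in X$, $\partial f(x)=\{v\in\mathbb R^n: f(z)\ge f(x)+\langle v,z-x\rangle\ \forall z\in X\}$. A first-order oracle returns, at any $u\in X$, $f(u)$ and a subgradient $g(u)\in\partial f(u)$; $\ell_f(x;u):=f(u)+\langle g(u),x-u\rangle$ is the corresponding cutting plane. Piecewise smoothness. $k\in\mathbb N_+$, $L>0$, and $f$ is $(k,L)$-piecewise smooth: there are $k$ subsets $X_1,\dots,X_k$ of $X$ (pieces) covering $X$ such that each restriction $f|_{X_i}$ is $L$-smooth; this is used together with the oracle assumption that $f(x)-\ell_f(x;\bar x)\le\frac L2\|x-\bar x\|^2$ for all $i\in\{1,\dots,k\}$ and all $x,\bar x\in X_i$. Quadratic growth. $\mu^*:=\sup\{\nu>0: f(x)-f^*\ge\frac\nu2\operatorname{dist}^2(x,X^* )\ \forall x\in X\}$, and $0<\mu^*<\infty$ is assumed. FM-PBM. Input $x^0\in X$, $\rho>0$, $\beta\in(0,1)$. Set $\psi^0=\ell_f(\cdot;x^0)$. For $t=0,1,\dots$: compute $y^t=\operatorname{argmin}_{x\in X}\{\psi^t(x)+\frac\rho2\|x-x^t\|^2\}$. If $f(x^t)-f(y^t)\ge\beta(f(x^t)-\psi^t(y^t))$, iteration $t$ is a serious step and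 $x^{t+1}=y^t$; otherwise it is a null step and $x^{t+1}=x^t$. Set $\psi^{t+1}(x)=\max\{\psi^t(x),\ell_f(x;y^t)\}$. The points $x^t$ are the (proximal) centers. The oracle is called once at $x^0$ and once at each trial point $y^t$. $O(\cdot)$ hides an absolute constant. *)

(* Defs.v *)
From mathcomp Require Import all_boot all_order all_algebra.
From mathcomp Require Import all_classical all_reals all_analysis.

Set Implicit Arguments.
Unset Strict Implicit.
Unset Printing Implicit Defensive.

Import Order.TTheory GRing.Theory Num.Theory.
Import numFieldNormedType.Exports.

Local Open Scope classical_set_scope.
Local Open Scope ring_scope.

Section Euclidean.
Context {R : realType} {n : nat}.
Implicit Types (u v : 'rV[R]_n) (A : set 'rV[R]_n).

Definition dotp u v : R := \sum_(i < n) u ord0 i * v ord0 i.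

(* The library norm `|u| on row vectors is the sup norm, hence this one; the
   two induce the same topology. *)
Definition enorm u : R := Num.sqrt (dotp u u).

Definition dist_set u A : R := inf [set enorm (u - v) | v in A].

End Euclidean.

(* Throughout, a function on X is a total function whose values outside X are
   never used. *)
Section Optimization.
Context {R : realType} {n : nat}.
Local Notation E := 'rV[R]_n.
Implicit Types (X A : set E) (f : E -> R) (g : E -> E).

Definition argmin X f : set E := [set x | X x /\ forall z, X z -> f x <= f z].

Definition min_val X f : R := inf (f @` X).

(* The topology of [subspace X] restricts to the relative topology on X and
   makes the points outside X isolated. *)
Definition lsc_on X f : Prop :=
  lower_semicontinuous (fun x : subspace X => (f x)%:E).

Definition subdifferential X f (x : E) : set E :=
  [set v | forall z, X z -> f x + dotp v (z - x) <= f z].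

Definition subgradient_oracle X f g : Prop :=
  forall u, X u -> subdifferential X f u (g u).

Definition cut f g (u x : E) : R := f u + dotp (g u) (x - u).

(* A need not be open: differentiability is relative to A, with some choice G
   of gradients of the restriction of f to A that is L-Lipschitz. *)
Definition smooth_on (L : R) A f : Prop :=
  exists G : E -> E,
    (forall x, A x -> forall e : R, 0 < e ->
       \forall z \near within A (nbhs x),
         `|f z - f x - dotp (G x) (z - x)| <= e * enorm (z - x)) /\
    (forall x z, A x -> A z -> enorm (G x - G z) <= L * enorm (x - z)).

Definition piecewise_smooth (k : nat) (L : R) X f (P : 'I_k -> set E) : Prop :=
  [/\ forall i, P i `<=` X,
      X `<=` \bigcup_(i in [set: 'I_k]) P i &
      forall i, smooth_on L (P i) f].

Definition pieces_oracle_bound (k : nat) (L : R) f g (P : 'I_k -> set E) :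
    Prop :=
  forall i x u, P i x -> P i u ->
    f x - cut f g u x <= L / 2 * enorm (x - u) ^+ 2.

(* Valued in \bar R, so that an empty or unbounded set of growth constants
   does not get a real value by convention. *)
Definition growth_modulus X f : \bar R :=
  ereal_sup [set nu%:E | nu in [set nu : R | 0 < nu /\
    forall x, X x ->
      nu / 2 * dist_set x (argmin X f) ^+ 2 <= f x - min_val X f]].

End Optimization.

Section FMPBM.
Context {R : realType} {n : nat}.
Local Notation E := 'rV[R]_n.
Variables (X : set E) (f : E -> R) (g : E -> E).
Variables (rho beta : R) (x0 : E).
Variables (x y : nat -> E) (psi : nat -> E -> R).

Definition serious_step (t : nat) : bool :=
  beta * (f (x t) - psi t (y t)) <= f (x t) - f (y t).

Record fm_pbm : Prop := FMPBM {
  fm_pbm_center0 : x 0%N = x0;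
  fm_pbm_model0 : forall z, psi 0%N z = cut f g x0 z;
  fm_pbm_trial : forall t,
    argmin X (fun z => psi t z + rho / 2 * enorm (z - x t) ^+ 2) (y t);
  fm_pbm_center : forall t, x t.+1 = if serious_step t then y t else x t;
  fm_pbm_model : forall t z, psi t.+1 z = Num.max (psi t z) (cut f g (y t) z)
}.

Definition serious_center (t : nat) : Prop :=
  exists s, t = s.+1 /\ serious_step s.

(* The oracle queries made up to the moment when x t is known: deciding
   whether iteration s is serious requires f (y s), for each s < t. *)
Definition oracle_queries (t : nat) : seq E := x0 :: mkseq y t.

End FMPBM.

Section Complexity.
Context {R : realType}.
Variables (mu rho beta L : R).

Definition log_base (b a : R) : R := ln a / ln b.

Definition gamma_rho : R := 1 - beta / Num.max 2 (4 * rho / mu).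

Definition theta_rho : R := L / (L + (1 - beta) * rho).

(* gap0 stands for f(x^0) - f^*. *)
Definition S_eps (gap0 eps : R) : int :=
  Num.ceil (log_base gamma_rho^-1
    (gap0 / (beta * Num.min (1 / 2) (mu / (4 * rho)) * eps))).

(* g0 stands for the norm of g(x^0). *)
Definition P_eps (gap0 g0 eps : R) : int :=
  Num.ceil (log_base theta_rho^-1
    ((3 - 2 * beta) ^ (S_eps gap0 eps) *
     Num.max 1 (g0 ^+ 2 / (Num.min rho (mu / 2) * eps)))).

End Complexity.

(* Main.v *)
Require Import Defs.
From mathcomp Require Import all_boot all_order all_algebra.
From mathcomp Require Import all_classical all_reals all_analysis.
From mathcomp Require Import ring lra zify.

Set Implicit Arguments.
Unset Strict Implicit.
Unset Printing Implicit Defensive.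

Import Order.TTheory GRing.Theory Num.Theory.
Import numFieldNormedType.Exports.

Local Open Scope classical_set_scope.
Local Open Scope ring_scope.

(** The whole argument follows one quantity, the proximal gap

      d_t = f(x^t) - min_X (psi^t + rho/2 |. - x^t|^2),

    the decrease that the model promises from the current center.

    - It bounds the optimality gap of the center: by quadratic growth, moving
      from x^t towards the minimizers shows d_t >= c (f(x^t) - fmin) with
      c = min(1/2, mu/(4 rho)) ([prox_value_growth]).  A serious step realizes
      a fraction beta of it, so the optimality gap is multiplied by at most
      1 - beta c = gamma_rho ([gap_serious]).
    - During a run of null steps d_t does not increase, since the model grows
      and the center is fixed.  If moreover two trial points of the run lie in
      the same piece, the cut taken at the first one is accurate to order
      L/2 |.|^2 at the second one, while strong convexity of the proximal
      subproblem charges rho/2 |.|^2 to the decrease of d_t; a null step at the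
      second point then forces d_t to shrink by theta_rho
      ([prox_gap_same_piece]).  By the pigeonhole principle this happens in
      every k+1 consecutive null steps ([prox_gap_block]).
    - The model is never discarded, so a serious step multiplies d_t by at most
      3 - 2 beta ([prox_gap_serious]), and the progress made by the null steps
      is carried over from one center to the next.

    Hence, after s serious steps and q full blocks of k+1 null steps,
    f(x^t) - fmin <= gamma^s (f(x^0) - fmin) and
    d <= (3 - 2 beta)^s theta^q d_0 with d_0 <= |g(x^0)|^2 / (2 rho)
    ([progress]).  As long as the optimality gap exceeds eps, the first bound
    gives s < S_eps and the second one, with d >= c eps, gives q < P_eps.  Each
    serious step ends at most one incomplete block of at most k null steps, so
    fewer than (k+1) (S_eps + P_eps) iterations are possible
    ([iterations_lt]), and the first center below eps is a serious one because
    null steps do not move the center. *)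

(** * The Euclidean inner product *)

Section EuclideanTheory.
Context {R : realType} {n : nat}.
Implicit Types (u v w : 'rV[R]_n) (A : set 'rV[R]_n).

Lemma dotpC u v : dotp u v = dotp v u.
Proof. by apply: eq_bigr => i _; rewrite mulrC. Qed.

Lemma dotpDl u v w : dotp (u + v) w = dotp u w + dotp v w.
Proof. by rewrite -big_split; apply: eq_bigr => i _; rewrite mxE mulrDl. Qed.

Lemma dotpZl a u v : dotp (a *: u) v = a * dotp u v.
Proof. by rewrite /dotp mulr_sumr; apply: eq_bigr => i _; rewrite mxE mulrA. Qed.

Lemma dotpDr u v w : dotp u (v + w) = dotp u v + dotp u w.
Proof. by rewrite dotpC dotpDl !(dotpC u). Qed.

Lemma dotpZr a u v : dotp u (a *: v) = a * dotp u v.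
Proof. by rewrite dotpC dotpZl dotpC. Qed.

Lemma dotpNl u v : dotp (- u) v = - dotp u v.
Proof. by rewrite -scaleN1r dotpZl mulN1r. Qed.

Lemma dotpNr u v : dotp u (- v) = - dotp u v.
Proof. by rewrite dotpC dotpNl dotpC. Qed.

Definition dotpE := (dotpDl, dotpDr, dotpZl, dotpZr, dotpNl, dotpNr).

Lemma dotp_ge0 u : 0 <= dotp u u.
Proof. by apply: sumr_ge0 => i _; rewrite -expr2 sqr_ge0. Qed.

Lemma enorm_ge0 u : 0 <= enorm u.
Proof. exact: sqrtr_ge0. Qed.

Lemma sqr_enorm u : enorm u ^+ 2 = dotp u u.
Proof. by rewrite sqr_sqrtr ?dotp_ge0. Qed.

Lemma dist_set_ge0 u A : 0 <= dist_set u A.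
Proof.
have [->|/set0P A0] := eqVneq A set0; first by rewrite /dist_set image_set0 inf0.
by apply: lb_le_inf; [exact: image_nonempty | move=> _ [v _ <-]; exact: enorm_ge0].
Qed.

(** Bounding the squared distances to all points of [A] avoids the existence of
    a projection onto [A]. *)
Lemma sqr_dist_set_ge u A c : A !=set0 ->
  (forall v, A v -> c <= enorm (u - v) ^+ 2) -> c <= dist_set u A ^+ 2.
Proof.
move=> A0 cA; have [c0|c0] := leP c 0; first exact: le_trans c0 (sqr_ge0 _).
rewrite -(sqr_sqrtr (ltW c0)) ler_sqr ?nnegrE ?sqrtr_ge0 ?dist_set_ge0//.
apply: lb_le_inf; first exact: image_nonempty.
move=> _ [v Av <-]; rewrite -(ler_sqr (sqrtr_ge0 _) (enorm_ge0 _)).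
by rewrite (sqr_sqrtr (ltW c0)); exact: cA.
Qed.

End EuclideanTheory.

(** * Convexity along segments, proximal steps and quadratic growth *)

Section ConvexTheory.
Context {R : realType} {n : nat}.
Implicit Types (X : set 'rV[R]_n) (f h : 'rV[R]_n -> R) (a b : 'rV[R]_n).

Let convE a b (l : {i01 R}) : @conv R (convex_lmodType 'rV[R]_n) l b a =
  a + l%:num *: (b - a).
Proof.
rewrite scalerBr addrCA; congr (_ + _).
by rewrite scalerBl scale1r.
Qed.

Lemma convex_set_segment X a b l : convex_set X -> X a -> X b -> 0 <= l <= 1 ->
  X (a + l *: (b - a)).
Proof.
move=> Xc Xa Xb l01.
have /set_mem := Xc b a (Itv01 (andP l01).1 (andP l01).2) (mem_set Xb) (mem_set Xa).
by rewrite convE.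
Qed.

Lemma convex_function_segment X h a b l : convex_function X h ->
  X a -> X b -> 0 <= l <= 1 ->
  h (a + l *: (b - a)) <= (1 - l) * h a + l * h b.
Proof.
move=> hc Xa Xb l01.
have := hc (Itv01 (andP l01).1 (andP l01).2) b a (mem_set Xb) (mem_set Xa).
by rewrite convE [X in _ <= X]addrC.
Qed.

(** First-order optimality of [q] along the segment to [z] says that
    h z - h q + rho <q - c, z - q> >= 0; expanding |z - c|^2 around [q] turns this
    into strong convexity of the proximal objective at its minimizer. *)
Lemma prox_three_point X h c q z rho : 0 < rho -> convex_set X ->
  convex_function X h ->
  argmin X (fun w => h w + rho / 2 * enorm (w - c) ^+ 2) q -> X z ->
  h q + rho / 2 * enorm (q - c) ^+ 2 + rho / 2 * enorm (z - q) ^+ 2 <=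
  h z + rho / 2 * enorm (z - c) ^+ 2.
Proof.
move=> rho0 Xc hc [Xq qmin] Xz.
have qseg l : 0 < l <= 1 ->
    0 <= h z - h q + rho * dotp (q - c) (z - q) +
      l * (rho / 2 * dotp (z - q) (z - q)).
  move=> /andP[l0 l1]; have l01 : 0 <= l <= 1 by rewrite (ltW l0).
  have := qmin _ (convex_set_segment Xc Xq Xz l01).
  have := convex_function_segment hc Xq Xz l01.
  rewrite !sqr_enorm (_ : q + l *: (z - q) - c = (q - c) + l *: (z - q)); last first.
    by rewrite addrAC.
  move: (q - c) (z - q) => u v; rewrite !dotpE (dotpC v u) => h1 h2.
  by rewrite -(pmulr_rge0 _ l0); nra.
have first_order : 0 <= h z - h q + rho * dotp (q - c) (z - q).
  move: qseg; move: (h z - h q + _) (rho / 2 * _) => A B qseg.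
  rewrite leNgt; apply/negP => A0.
  have AB := qseg 1; rewrite lexx ltr01 in AB; have {}AB := AB erefl.
  have B0 : 0 < B by lra.
  (* at this l the sum A + l B equals A / 2 < 0; it is below 1 as A + B >= 0 *)
  have := qseg (- A / (2 * B)); rewrite divr_gt0 ?mulr_gt0 ?oppr_gt0//=.
  rewrite ler_pdivrMr ?mulr_gt0// => /(_ ltac:(lra)).
  by rewrite (_ : - A / (2 * B) * B = - A / 2); [lra | field; rewrite gt_eqF].
rewrite !sqr_enorm (_ : z - c = (z - q) + (q - c)); last by rewrite addrA subrK.
by move: first_order; move: (q - c) (z - q) => u v; rewrite !dotpE (dotpC v u); lra.
Qed.

Lemma argmin_min_val X f xs : argmin X f xs -> min_val X f = f xs.
Proof.
move=> [Xxs xsmin]; apply/eqP; rewrite eq_le; apply/andP; split.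
  by apply: ge_inf; [exists (f xs) => _ [z Xz <-]; exact: xsmin | exists xs].
by apply: lb_le_inf; [exists (f xs), xs | move=> _ [z Xz <-]; exact: xsmin].
Qed.

Lemma min_val_le X f z : argmin X f !=set0 -> X z -> min_val X f <= f z.
Proof. by move=> [xs xsP] Xz; rewrite (argmin_min_val xsP); exact: xsP.2. Qed.

(** The supremum defining the growth modulus is attained: for a point at
    positive distance, the growth inequality bounds every admissible constant
    by one and the same number. *)
Lemma quadratic_growth X f mu z : argmin X f !=set0 ->
  growth_modulus X f = mu%:E -> X z ->
  mu / 2 * dist_set z (argmin X f) ^+ 2 <= f z - min_val X f.
Proof.
move=> f0 mumod Xz; set D := dist_set _ _ ^+ 2.
have := sqr_ge0 (dist_set z (argmin X f)); rewrite -/D le_eqVlt => /predU1P[<-|D0].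
  by rewrite mulr0 subr_ge0 min_val_le.
suff: mu <= (f z - min_val X f) * 2 / D.
  by rewrite ler_pdivlMr//; lra.
rewrite -lee_fin -mumod; apply: ge_ereal_sup => _ [nu [nu0 nuP] <-].
by rewrite lee_fin ler_pdivlMr//; have := nuP z Xz; rewrite -/D; lra.
Qed.

(** Any lower model [h] of [f] has a proximal value no larger than that of [f],
    which is estimated at the points c + l (xs - c) for minimizers xs: the
    decrease is at least l G - rho/2 l^2 |c - xs|^2, where G is the optimality
    gap of [c] and |c - xs|^2 may be replaced by 2 G / mu.  The best l is
    min(1, mu / (2 rho)). *)
Lemma prox_value_growth X f h mu rho c q : 0 < rho -> 0 < mu ->
  convex_set X -> convex_function X f -> argmin X f !=set0 ->
  growth_modulus X f = mu%:E -> X c ->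
  (forall z, X z -> h z <= f z) ->
  argmin X (fun w => h w + rho / 2 * enorm (w - c) ^+ 2) q ->
  Num.min (1 / 2) (mu / (4 * rho)) * (f c - min_val X f) <=
  f c - (h q + rho / 2 * enorm (q - c) ^+ 2).
Proof.
move=> rho0 mu0 Xc fc f0 mumod Xcc hf [Xq qmin].
set d := (X in _ <= X); set G := f c - _.
have G0 : 0 <= G by rewrite subr_ge0 min_val_le.
have dist_bound l : 0 < l <= 1 -> l * G - d <= rho / 2 * l ^+ 2 * (2 * G / mu).
  move=> /andP[l0 l1]; have l01 : 0 <= l <= 1 by rewrite (ltW l0).
  have rl0 : 0 < rho / 2 * l ^+ 2 by rewrite mulr_gt0 ?divr_gt0 ?exprn_gt0.
  rewrite [leRHS]mulrC -ler_pdivrMr//.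
  apply: (@le_trans _ _ (dist_set c (argmin X f) ^+ 2)); last first.
    by rewrite ler_pdivlMr//; have := quadratic_growth f0 mumod Xcc; rewrite -/G; lra.
  apply: sqr_dist_set_ge => // xs xsP; rewrite ler_pdivrMr//.
  have Xseg := convex_set_segment Xc Xcc xsP.1 l01.
  have := convex_function_segment fc Xcc xsP.1 l01.
  have := hf _ Xseg; have := qmin _ Xseg.
  rewrite /d /G (argmin_min_val xsP) addrAC subrr add0r -(opprB xs c).
  move: (enorm (q - c) ^+ 2) (c + _) => e b; rewrite !sqr_enorm.
  by move: (xs - c) => w; rewrite !dotpE opprK; nra.
have [small|large] := leP (1 / 2) (mu / (4 * rho)).
  have := dist_bound 1; rewrite lexx ltr01 => /(_ erefl).
  move: small; rewrite ler_pdivlMr ?mulr_gt0// => small.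
  have : G / mu * rho <= G / 2.
    by rewrite mulrAC ler_pdivrMr//; nra.
  lra.
have := dist_bound (mu / (2 * rho)); rewrite divr_gt0 ?mulr_gt0//=.
move: large; rewrite ltr_pdivrMr ?mulr_gt0// => large.
rewrite ler_pdivrMr ?mulr_gt0// => /(_ ltac:(lra)).
rewrite (_ : rho / 2 * _ * _ = mu / (4 * rho) * G); last by field; rewrite !gt_eqF.
rewrite (_ : mu / (2 * rho) = 2 * (mu / (4 * rho))); last by field; rewrite gt_eqF.
lra.
Qed.

End ConvexTheory.

(** * The two rates *)

Section Rates.
Context {R : realType}.
Variables (mu rho beta L : R).
Hypotheses (mu_gt0 : 0 < mu) (rho_gt0 : 0 < rho) (L_gt0 : 0 < L).
Hypothesis beta01 : 0 < beta < 1.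

(** The fraction of the optimality gap that a proximal step is certain to
    predict as decrease. *)
Definition growth_rate : R := Num.min (1 / 2) (mu / (4 * rho)).

Lemma growth_rate_gt0 : 0 < growth_rate.
Proof. by rewrite lt_min !divr_gt0// mulr_gt0. Qed.

Lemma growth_rate_le_half : growth_rate <= 1 / 2.
Proof. by rewrite ge_min lexx. Qed.

Lemma gamma_rhoE : gamma_rho mu rho beta = 1 - beta * growth_rate.
Proof.
rewrite /gamma_rho /growth_rate; congr (1 - beta * _).
have -> : mu / (4 * rho) = (4 * rho / mu)^-1 by rewrite invf_div.
rewrite div1r; have q0 : 0 < 4 * rho / mu by rewrite divr_gt0 ?mulr_gt0.
have [le2|lt2] := leP 2 (4 * rho / mu).
  by rewrite min_r// lef_pV2 ?posrE.
by rewrite min_l// lef_pV2 ?posrE// ltW.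
Qed.

Lemma gamma_rho_gt0 : 0 < gamma_rho mu rho beta.
Proof.
rewrite gamma_rhoE; have := growth_rate_le_half; have := growth_rate_gt0.
have /andP[b0 b1] := beta01; nra.
Qed.

Lemma gamma_rho_lt1 : gamma_rho mu rho beta < 1.
Proof.
rewrite gamma_rhoE gtrBl mulr_gt0 ?growth_rate_gt0//.
by have /andP[] := beta01.
Qed.

Lemma theta_rho_gt0 : 0 < theta_rho rho beta L.
Proof.
by have /andP[b0 b1] := beta01; rewrite /theta_rho divr_gt0 ?addr_gt0 ?mulr_gt0 ?subr_gt0.
Qed.

Lemma theta_rho_lt1 : theta_rho rho beta L < 1.
Proof.
have /andP[b0 b1] := beta01.
by rewrite /theta_rho ltr_pdivrMr ?mul1r ?ltrDl ?addr_gt0 ?mulr_gt0 ?subr_gt0.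
Qed.

Lemma ltr_log_base (c a : R) (j : nat) : 0 < c < 1 -> 0 < a -> 1 < c ^+ j * a ->
  j%:R < log_base c^-1 a.
Proof.
move=> /andP[c0 c1] a0 lt_ca.
have lnc : 0 < ln c^-1 by rewrite ln_gt0// invf_gt1.
rewrite /log_base ltr_pdivlMr// mulr_natl -lnXn ?invr_gt0//.
rewrite ltr_ln ?posrE ?exprn_gt0 ?invr_gt0//.
by rewrite exprVn -div1r ltr_pdivrMr ?exprn_gt0// mulrC.
Qed.

End Rates.

(** * One iteration of the bundle method *)

Section ProximalBundle.
Context {R : realType} {n : nat}.
Variables (X : set 'rV[R]_n) (f : 'rV[R]_n -> R) (g : 'rV[R]_n -> 'rV[R]_n).
Variables (rho beta : R) (x0 : 'rV[R]_n).
Variables (x y : nat -> 'rV[R]_n) (psi : nat -> 'rV[R]_n -> R).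
Hypotheses (X_convex : convex_set X) (f_convex : convex_function X f).
Hypothesis g_oracle : subgradient_oracle X f g.
Hypotheses (rho_gt0 : 0 < rho) (beta01 : 0 < beta < 1) (Xx0 : X x0).
Hypothesis bundle : fm_pbm X f g rho beta x0 x y psi.

Local Notation serious := (serious_step f beta x y psi).

Lemma trial_mem t : X (y t).
Proof. exact: (fm_pbm_trial bundle t).1. Qed.

Lemma center_mem t : X (x t).
Proof.
elim: t => [|t IH]; first by rewrite (fm_pbm_center0 bundle).
by rewrite (fm_pbm_center bundle); case: ifP => _ //; exact: trial_mem.
Qed.

Lemma model_le t z : X z -> psi t z <= f z.
Proof.
move=> Xz; elim: t => [|t IH].
  by rewrite (fm_pbm_model0 bundle); exact: g_oracle.
by rewrite (fm_pbm_model bundle) ge_max IH /=; exact: g_oracle (trial_mem t) _ Xz.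
Qed.

Lemma model_mono s t z : (s <= t)%N -> psi s z <= psi t z.
Proof.
move=> /subnKC <-; elim: (t - s)%N => [|d IH]; first by rewrite addn0.
by rewrite addnS (fm_pbm_model bundle) le_max IH.
Qed.

Lemma cut_le_model s t z : (s < t)%N -> Defs.cut f g (y s) z <= psi t z.
Proof.
move=> /(model_mono z); apply: le_trans.
by rewrite (fm_pbm_model bundle) le_max lexx orbT.
Qed.

(** The model is a maximum of affine functions. *)
Lemma model_convex t : convex_function X (psi t).
Proof.
have cutE u (l : {i01 R}) a b :
    Defs.cut f g u (l%:num *: a + (1 - l%:num) *: b) =
    l%:num * Defs.cut f g u a + (1 - l%:num) * Defs.cut f g u b.
  by rewrite /Defs.cut !dotpE; ring.
move=> l a b _ _; rewrite [leRHS]/(l%:num * _ + (1 - l%:num) * _).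
rewrite [conv l a b]/(l%:num *: a + (1 - l%:num) *: b).
have l0 : 0 <= l%:num by [].
have l1 : 0 <= 1 - l%:num by rewrite subr_ge0.
elim: t => [|t IH]; first by rewrite !(fm_pbm_model0 bundle) cutE.
rewrite !(fm_pbm_model bundle) ge_max; apply/andP; split.
  apply: le_trans IH _.
  by apply: lerD; apply: ler_wpM2l; rewrite ?le_max ?lexx.
by rewrite cutE; apply: lerD; apply: ler_wpM2l; rewrite ?le_max ?lexx ?orbT.
Qed.

Lemma prox_step t z : X z ->
  psi t (y t) + rho / 2 * enorm (y t - x t) ^+ 2 + rho / 2 * enorm (z - y t) ^+ 2
  <= psi t z + rho / 2 * enorm (z - x t) ^+ 2.
Proof.
exact: prox_three_point rho_gt0 X_convex (@model_convex t) (fm_pbm_trial bundle t).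
Qed.

(** The decrease of the objective from the center [x t] to the optimal value of
    the proximal subproblem, the potential of the analysis. *)
Definition prox_gap t : R :=
  f (x t) - (psi t (y t) + rho / 2 * enorm (y t - x t) ^+ 2).

(** Strong convexity of the subproblem compared with its value at the center,
    where the model does not exceed [f]. *)
Lemma center_move_le_prox_gap t :
  rho / 2 * enorm (y t - x t) ^+ 2 <= prox_gap t.
Proof.
have := prox_step t (center_mem t); have := model_le t (center_mem t).
rewrite /prox_gap !sqr_enorm subrr -(opprB (y t) (x t)).
move: (y t - x t) => u.
have -> : dotp (0 : 'rV[R]_n) 0 = 0 by rewrite -(scale0r 0) dotpZl mul0r.
rewrite !dotpE; lra.
Qed.

(** The initial model is affine; completing the square minimizes it together
    with the proximal term. *)
Lemma prox_gap_init : prox_gap 0 <= enorm (g x0) ^+ 2 / (2 * rho).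
Proof.
rewrite /prox_gap (fm_pbm_model0 bundle) (fm_pbm_center0 bundle) /Defs.cut !sqr_enorm.
move: (y 0%N - x0) => u; rewrite ler_pdivlMr ?mulr_gt0//.
have := dotp_ge0 (g x0 + rho *: u); rewrite !dotpE (dotpC u).
move: (dotp _ _) (dotp _ _) (dotp _ _) => *; nra.
Qed.

(** With a fixed center the proximal value can only increase, and strong
    convexity converts the displacement of the trial point into progress. *)
Lemma prox_gap_same_center s t : (s <= t)%N -> x s = x t ->
  prox_gap t + rho / 2 * enorm (y t - y s) ^+ 2 <= prox_gap s.
Proof.
move=> st xst; have := prox_step s (trial_mem t); have := model_mono (y t) st.
by rewrite /prox_gap xst; lra.
Qed.

Lemma center_null t : ~~ serious t -> x t.+1 = x t.
Proof. by rewrite (fm_pbm_center bundle) => /negbTE ->. Qed.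

Lemma center_serious t : serious t -> x t.+1 = y t.
Proof. by rewrite (fm_pbm_center bundle) => ->. Qed.

Lemma center_nulls a d : (forall i, (i < d)%N -> ~~ serious (a + i)) ->
  x (a + d)%N = x a.
Proof.
elim: d => [|d IH] null; first by rewrite addn0.
rewrite addnS center_null ?IH// ?null// => i id; exact/null/ltnW.
Qed.

Lemma prox_gap_nulls a d : (forall i, (i < d)%N -> ~~ serious (a + i)) ->
  prox_gap (a + d) <= prox_gap a.
Proof.
move=> /center_nulls xad.
have := prox_gap_same_center (leq_addr d a) (esym xad).
by apply: le_trans; rewrite lerDl mulr_ge0 ?sqr_ge0// divr_ge0// ltW.
Qed.

(** Since the old cuts are kept, the old subproblem bounds the new model from
    below: psi z >= m + rho/2 |z - y|^2 - rho/2 |z - x|^2, where m is the old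
    proximal value.  Adding the proximal term centered at y and minimizing over
    z loses rho |y - x|^2, so the new gap is at most
    f y - psi y + rho/2 |y - x|^2.  The serious test bounds f y - psi y by
    (1 - beta) (d + rho/2 |y - x|^2), and rho/2 |y - x|^2 <= d, whence
    the factor 2 (1 - beta) + 1 = 3 - 2 beta. *)
Lemma prox_gap_serious t : serious t ->
  prox_gap t.+1 <= (3 - 2 * beta) * prox_gap t.
Proof.
move=> ser; have move_le := center_move_le_prox_gap t.
move: (ser); rewrite /serious_step => descent.
have := prox_step t (trial_mem t.+1); have := model_mono (y t.+1) (leqnSn t).
move: move_le; rewrite /prox_gap (center_serious ser) !sqr_enorm.
rewrite (_ : y t.+1 - x t = (y t.+1 - y t) + (y t - x t)); last by rewrite addrA subrK.
move: (y t.+1 - y t) (y t - x t) => u v.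
have : 0 <= rho * dotp (u - v) (u - v) by rewrite mulr_ge0 ?dotp_ge0// ltW.
rewrite !dotpE (dotpC v u).
move: (dotp u u) (dotp u v) (dotp v v) => uu uv vv sq move_le model_le prox.
have /andP[_ b1] := beta01.
have : 0 <= (1 - beta) * (f (x t) - psi t (y t) - rho * vv).
  by apply: mulr_ge0; lra.
lra.
Qed.

Lemma gap_serious mu t : 0 < mu -> argmin X f !=set0 ->
  growth_modulus X f = mu%:E -> serious t ->
  f (x t.+1) - min_val X f <= gamma_rho mu rho beta * (f (x t) - min_val X f).
Proof.
move=> mu0 f0 mumod ser.
have := prox_value_growth rho_gt0 mu0 X_convex f_convex f0 mumod (center_mem t)
  (@model_le t) (fm_pbm_trial bundle t).
move: (ser); rewrite /serious_step (center_serious ser) gamma_rhoE//.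
have : 0 <= rho / 2 * enorm (y t - x t) ^+ 2.
  by rewrite mulr_ge0 ?sqr_ge0// divr_ge0// ltW.
rewrite -/(growth_rate mu rho); move: (growth_rate _ _) (rho / 2 * _) => c m.
move=> m0 descent growth.
have /andP[b0 _] := beta01.
have : 0 <= beta * (f (x t) - (psi t (y t) + m) - c * (f (x t) - min_val X f)) by apply: mulr_ge0; lra.
have : 0 <= beta * m by apply: mulr_ge0; lra.
lra.
Qed.

(** * Pieces and blocks of null steps *)

Section Pieces.
Variables (k : nat) (L : R) (pieces : 'I_k -> set 'rV[R]_n).
Hypotheses (L_gt0 : 0 < L) (pieces_cover : X `<=` \bigcup_(i in setT) pieces i).
Hypothesis pieces_bound : pieces_oracle_bound L f g pieces.

(** A failed descent test means that the model error f y - psi y at y = y t is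
    at least (1 - beta) d_t.  The cut at y s makes this error at most
    L/2 |y t - y s|^2, and [prox_gap_same_center] makes that at most
    (L / rho) (d_s - d_t). *)
Lemma prox_gap_same_piece s t i : (s < t)%N -> x s = x t -> ~~ serious t ->
  pieces i (y s) -> pieces i (y t) ->
  prox_gap t <= theta_rho rho beta L * prox_gap s.
Proof.
move=> st xst null ys yt.
have := prox_gap_same_center (ltnW st) xst.
have := pieces_bound yt ys; have := cut_le_model (y t) st.
move: null; rewrite /serious_step -ltNge => null cut_le bound prox.
have /andP[b0 b1] := beta01.
have dv : prox_gap t <= f (x t) - psi t (y t).
  rewrite /prox_gap opprD addrA gerBl mulr_ge0 ?sqr_ge0//.
  by rewrite divr_ge0// ltW.
rewrite /theta_rho mulrAC ler_pdivlMr; last first.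
  by rewrite addr_gt0// mulr_gt0// subr_gt0.
move: (prox_gap t) (prox_gap s) prox dv => dt ds prox dv.
move: bound prox; move: (enorm _ ^+ 2) => e bound prox.
have : 0 <= (1 - beta) * (f (x t) - psi t (y t) - dt).
  by apply: mulr_ge0; lra.
have : 0 <= L * (ds - dt - rho / 2 * e).
  by apply: mulr_ge0; [exact: ltW | lra].
move=> Lprox dvb; have : 0 <= rho * (L / 2 * e - (1 - beta) * dt).
  by apply: mulr_ge0; [exact: ltW | lra].
lra.
Qed.

(** Among k+1 trial points two share a piece; the steps of the block before the
    first and after the second do not increase the proximal gap. *)
Lemma prox_gap_block a : (forall i, (i < k.+1)%N -> ~~ serious (a + i)) ->
  prox_gap (a + k.+1) <= theta_rho rho beta L * prox_gap a.
Proof.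
move=> null.
have [p pP] : exists p : 'I_k.+1 -> 'I_k, forall j, pieces (p j) (y (a + j)%N).
  have /choice[p pP] : forall j : 'I_k.+1, exists i, pieces i (y (a + j)%N).
    by move=> j; have [i _ yi] := pieces_cover (trial_mem (a + j)); exists i.
  by exists p.
have /injectivePn[i [j ij pij]] : ~~ injectiveb p.
  by apply/injectiveP => /leq_card; rewrite !card_ord ltnn.
wlog lt_ij : i j ij pij / (i < j)%N => [IH|].
  by case: (ltngtP i j) => [/IH|/IH|/val_inj eqij];
    [exact | rewrite eq_sym; exact | rewrite eqij eqxx in ij].
have null_from d c : (d + c <= k.+1)%N -> forall e, (e < c)%N -> ~~ serious (a + d + e).
  by move=> dc e ec; rewrite -addnA; apply: null; lia.
have xa c : (c <= k.+1)%N -> x (a + c)%N = x a.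
  by move=> ck; apply: center_nulls => e ec; apply: null; lia.
have theta_ge0 : 0 <= theta_rho rho beta L.
  have /andP[b0 b1] := beta01.
  by rewrite divr_ge0 ?ltW// addr_gt0// mulr_gt0// subr_gt0.
have after : prox_gap (a + k.+1) <= prox_gap (a + j).
  have := @prox_gap_nulls (a + j) (k.+1 - j).
  rewrite -addnA subnKC; last exact: ltnW.
  by apply; apply: null_from; rewrite subnKC// ltnW.
have before : prox_gap (a + i) <= prox_gap a.
  by apply: prox_gap_nulls => e ei; apply: null; have := ltn_ord i; lia.
apply: (le_trans after).
apply: (le_trans _ (ler_wpM2l theta_ge0 before)).
apply: (prox_gap_same_piece (i := p j)).
- by rewrite ltn_add2l.
- by rewrite !xa// ltnW.
- exact: null.
- by rewrite -pij.
- exact: pP.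
Qed.

(** * Counting the iterations *)

Variable mu : R.
Hypotheses (mu_gt0 : 0 < mu) (f_min : argmin X f !=set0).
Hypothesis mu_modulus : growth_modulus X f = mu%:E.

Let gap t := f (x t) - min_val X f.
Let gamma := gamma_rho mu rho beta.
Let theta := theta_rho rho beta L.

(** The bookkeeping of the run: [s] serious steps and [q] completed blocks of
    k+1 null steps lie before [a], where the current block of [r] <= [k] null
    steps starts.  A serious step abandons an incomplete block, so it accounts,
    with that block, for at most k+1 iterations as well. *)
Lemma progress t : exists a r s q : nat,
  [/\ t = (a + r)%N, (r <= k)%N, forall i, (i < r)%N -> ~~ serious (a + i),
      (a <= k.+1 * (s + q))%N &
      prox_gap a <= (3 - 2 * beta) ^+ s * theta ^+ q * prox_gap 0 /\
      gap t <= gamma ^+ s * gap 0].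
Proof.
have theta_ge0 : 0 <= theta by exact/ltW/theta_rho_gt0.
have gamma_ge0 : 0 <= gamma by exact/ltW/gamma_rho_gt0.
have b32 : 0 <= 3 - 2 * beta by have /andP[_ b1] := beta01; lra.
elim: t => [|t [a [r [s [q [-> rk null a_le [gapa gapt]]]]]]].
  exists 0%N, 0%N, 0%N, 0%N; split=> //.
  by rewrite !expr0 !mul1r.
have [ser|nser] := boolP (serious (a + r)).
  exists (a + r).+1, 0%N, s.+1, q; split=> //.
  - by rewrite addn0.
  - by rewrite -addnS addSn mulnS (addnC a) leq_add.
  split.
    apply: (le_trans (prox_gap_serious ser)).
    rewrite exprS -!mulrA ler_wpM2l// mulrA.
    exact: le_trans (prox_gap_nulls null) gapa.
  apply: (le_trans (gap_serious mu_gt0 f_min mu_modulus ser)).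
  by rewrite exprS -mulrA ler_wpM2l.
have null' i : (i < r.+1)%N -> ~~ serious (a + i).
  by rewrite ltnS leq_eqVlt => /predU1P[->//|]; exact: null.
have gapt' : gap (a + r).+1 <= gamma ^+ s * gap 0 by rewrite /gap center_null.
have [rk'|kr] := ltnP r k.
  by exists a, r.+1, s, q; split=> //; rewrite addnS.
have rE : r = k by apply/eqP; rewrite eqn_leq rk.
rewrite rE -addnS in null' gapt' *.
exists (a + k.+1)%N, 0%N, s, q.+1; rewrite addn0; split=> //.
  by rewrite (addnS s) mulnS addnC leq_add2l.
split=> //; apply: (le_trans (prox_gap_block null')).
have -> : (3 - 2 * beta) ^+ s * theta ^+ q.+1 * prox_gap 0 =
    theta * ((3 - 2 * beta) ^+ s * theta ^+ q * prox_gap 0).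
  by rewrite exprS; ring.
by rewrite ler_wpM2l.
Qed.

(** Above the accuracy [eps], both counters of [progress] are below their
    logarithmic budgets. *)
Lemma iterations_lt eps t : 0 < eps -> eps < gap t ->
  t%:Z < k.+1%:Z * (S_eps mu rho beta (gap 0) eps +
                    P_eps mu rho beta L (gap 0) (enorm (g x0)) eps).
Proof.
move=> eps0 epst; have /andP[b0 b1] := beta01.
have c0 := growth_rate_gt0 mu_gt0 rho_gt0.
have c12 := growth_rate_le_half mu rho.
have [a [r [s [q [tE rk null a_le [gapa gapt]]]]]] := progress t.
have theta01 : 0 < theta < 1 by rewrite theta_rho_gt0 ?theta_rho_lt1.
have gamma01 : 0 < gamma < 1 by rewrite gamma_rho_gt0 ?gamma_rho_lt1.
have gap00 : 0 < gap 0.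
  have := lt_le_trans (lt_trans eps0 epst) gapt.
  by rewrite pmulr_rgt0// exprn_gt0//; case/andP: gamma01.
have sS : s%:Z < S_eps mu rho beta (gap 0) eps.
  rewrite /S_eps -/(growth_rate mu rho) ceil_gt_int.
  apply: ltr_log_base => //; first by rewrite divr_gt0// !mulr_gt0.
  rewrite mulrA ltr_pdivlMr ?mulr_gt0// mul1r.
  apply: lt_le_trans gapt; apply: le_lt_trans epst.
  by rewrite ler_piMl ?(ltW eps0)//; nra.
have qP : q%:Z < P_eps mu rho beta L (gap 0) (enorm (g x0)) eps.
  rewrite /P_eps ceil_gt_int.
  case: (S_eps _ _ _ _ _) sS => [S|//]; rewrite ltz_nat => sS.
  set h := Num.max _ _; have h1 : 1 <= h by rewrite le_max lexx.
  have b32 : 1 <= 3 - 2 * beta by lra.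
  apply: ltr_log_base => //.
    by apply: mulr_gt0; [apply: exprn_gt0|]; lra.
  (* the lower bound c eps on d against the initial |g(x0)|^2 / (2 rho) *)
  have minE : Num.min rho (mu / 2) * eps = growth_rate mu rho * eps * (2 * rho).
    rewrite mulrAC; congr (_ * eps); rewrite /growth_rate minr_pMl ?mulr_ge0 ?ltW//.
    by congr Num.min; field; rewrite ?gt_eqF.
  have gapaE : gap a = gap t by rewrite /gap tE (center_nulls null).
  have : growth_rate mu rho * eps <
      (3 - 2 * beta) ^+ s * theta ^+ q * (enorm (g x0) ^+ 2 / (2 * rho)).
    apply: (@lt_le_trans _ _ (growth_rate mu rho * gap a)).
      by rewrite ltr_pM2l// gapaE.
    apply: (le_trans (prox_value_growth rho_gt0 mu_gt0 X_convex f_convex f_min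
      mu_modulus (center_mem a) (@model_le a) (fm_pbm_trial bundle a))).
    apply: (le_trans gapa); rewrite ler_wpM2l ?prox_gap_init//.
    by apply: mulr_ge0; apply: exprn_ge0; [lra | exact/ltW/(andP theta01).1].
  rewrite -[ltLHS]mul1r -ltr_pdivlMr ?mulr_gt0// => /lt_le_trans; apply.
  have ratioE : enorm (g x0) ^+ 2 / (2 * rho) / (growth_rate mu rho * eps) =
      enorm (g x0) ^+ 2 / (Num.min rho (mu / 2) * eps).
    by rewrite minE -mulrA -invfM (mulrC (2 * rho)).
  rewrite -[leLHS]mulrA ratioE (mulrC _ (theta ^+ q)) -mulrA.
  rewrite ler_wpM2l ?exprn_ge0 ?(ltW (andP theta01).1)//.
  apply: ler_pM; [exact: exprn_ge0 (le_trans ler01 b32)| | |].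
  - by rewrite divr_ge0 ?sqr_ge0// minE !mulr_ge0 ?ltW.
  - by rewrite -exprnP ler_weXn2l// ltnW.
  - by rewrite le_max lexx orbT.
have : (t < k.+1 * (s + q).+1)%N by rewrite tE mulnS addnC -addSn leq_add.
move: sS qP; clear.
by case: (S_eps _ _ _ _ _) => [S|//]; case: (P_eps _ _ _ _ _ _ _) => [P|//]; nia.
Qed.

End Pieces.
End ProximalBundle.

Theorem theorem4p2 :
  exists C : nat,
  forall (R : realType) (n : nat) (X : set 'rV[R]_n)
    (f : 'rV[R]_n -> R) (g : 'rV[R]_n -> 'rV[R]_n)
    (k : nat) (L : R) (pieces : 'I_k -> set 'rV[R]_n) (mu : R)
    (rho beta eps : R) (x0 : 'rV[R]_n)
    (x y : nat -> 'rV[R]_n) (psi : nat -> 'rV[R]_n -> R),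
  X !=set0 -> closed X -> convex_set X ->
  convex_function X f -> lsc_on X f -> argmin X f !=set0 ->
  subgradient_oracle X f g ->
  (0 < k)%N -> 0 < L ->
  piecewise_smooth L X f pieces -> pieces_oracle_bound L f g pieces ->
  growth_modulus X f = mu%:E -> 0 < mu ->
  0 < rho -> 0 < beta < 1 -> X x0 ->
  0 < eps < f x0 - min_val X f ->
  fm_pbm X f g rho beta x0 x y psi ->
  let S := S_eps mu rho beta (f x0 - min_val X f) eps in
  let P := P_eps mu rho beta L (f x0 - min_val X f) (enorm (g x0)) eps in
  exists t : nat,
    [/\ serious_center f beta x y psi t,
        f (x t) - min_val X f <= eps &
        (size (oracle_queries x0 y t))%:Z <= C%:Z * (k%:Z * (S + P))].
Proof.
(* (k+1) M + 1 <= 3 k M for k, M >= 1, where the size counts x0 and t.+1 trial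
   points for the first good center x t.+1 *)
exists 3%N => R n X f g k L pieces mu rho beta eps x0 x y psi.
move=> _ _ X_convex f_convex _ f_min g_oracle k0 L0 [_ cover _] bound mumod mu0.
move=> rho0 beta01 Xx0 /andP[eps0 eps_lt] bundle S P.
have x0E : x 0%N = x0 by exact: fm_pbm_center0 bundle.
have few t : eps < f (x t) - min_val X f -> t%:Z < k.+1%:Z * (S + P).
  rewrite /S /P -{1 2}x0E.
  exact: (iterations_lt X_convex f_convex g_oracle rho0 beta01 Xx0 bundle L0
    cover bound mu0 f_min mumod eps0).
have reached : exists t, f (x t) - min_val X f <= eps.
  exists (absz (k.+1%:Z * (S + P))); rewrite leNgt; apply/negP => /few.
  have := few 0%N; rewrite x0E => /(_ eps_lt); lia.
have := ex_minnP reached => -[[|t] t_eps t_min].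
  by move: t_eps; rewrite x0E leNgt eps_lt.
have t_gap : eps < f (x t) - min_val X f.
  by rewrite ltNge; apply/negP => /t_min; rewrite ltnn.
exists t.+1; split=> //.
  exists t; split=> //; apply: contraLR t_gap => /(center_null bundle) xtE.
  by rewrite -leNgt -xtE.
have := few t t_gap; rewrite -[size _]/(size (mkseq y t.+1)).+1 size_mkseq.
move: (S + P) k0 => M; clear; nia.
Qed.
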